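(* Let $(\mathfrak{Z},\zeta)$ be the locally finite metric space $\mathfrak{Z}=\coprod_{n\in 2\mathbb{N}}\mathsf{M}_n$ (the disjoint union, over all positive even integers $n$, of the finite metric spaces $(\mathsf{M}_n,d_\infty)$ described in the context), with metric $\zeta$ such that $\zeta$ restricted to any $\mathsf{M}_n$ is the original metric $d_\infty$ on $\mathsf{M}_n$, and such that $\zeta(x,y)=4^{m+n}$ if $x\in\mathsf{M}_m$ and $y\in\mathsf{M}_n$ with $m\neq n$. Then $(\mathfrak{Z},\zeta)$ does not coarsely embed into any metric space of non zero generalized roundness; that is, if $(B,d)$ is a metric space with $\mathfrak{q}(B)>0$ (possibly $\mathfrak{q}(B)=\infty$), then there is no coarse embedding $f:\mathfrak{Z}\to B$.
   Context: For a positive even integer $n$, $\mathsf{L}_n=\{k n^{-n}: k\in\mathbb{Z},\ 1\leq k\leq n^{2n}\}$ with the cyclic metric $\chi(x,y)=\min\{|x-y|,\,n^n-|x-y|\}$. $\mathsf{M}_n=\prod_{i=1}^{n^n}\mathsf{L}_n$ with the metric $d_\infty(x,y)=\max_{1\leq i\leq n^n}\chi(x_i,y_i)$. A metric space is locally finite if every ball of finite radius is a finite set. The generalized roundness $\mathfrak{q}(X)\in[0,\infty]$ of a metric space $(X,d)$ is the supremum of the set of all $p\geq 0$ such that for all integers $n\geq 2$ and all (not necessarily distinct) points $x_1,\dots,x_n,y_1,\dots,y_n\in X$, $$\sum_{1\leq i<j\leq n}\{d(x_i,x_j)^p+d(y_i,y_j)^p\}\leq\sum_{1\leq i,j\leq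 n}d(x_i,y_j)^p.$$ A map $f$ from a metric space $(X,d)$ into a metric space $(Y,\varsigma)$ is a coarse embedding if there exist non-decreasing functions $\rho_1,\rho_2:[0,\infty)\to[0,\infty)$ with $\rho_1(d(x,y))\leq\varsigma(f(x),f(y))\leq\rho_2(d(x,y))$ for all $x,y\in X$ and $\lim_{t\to\infty}\rho_1(t)=\infty$.
   Formalization: The function ζ described is not a metric (the triangle inequality fails for two far points of M_8 and a point of M_2), so ζ is taken as the function given by these formulas; local finiteness and non-embeddability are proved for it, and ''ζ is a metric'' is not claimed. *)

(* Defs.v *)
From HB Require Import structures.
From mathcomp Require Import all_boot all_order all_algebra.
From mathcomp Require Import all_classical all_reals all_analysis.

Set Implicit Arguments.
Unset Strict Implicit.
Unset Printing Implicit Defensive.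

Import Order.TTheory GRing.Theory Num.Theory.
Import numFieldNormedType.Exports.

Local Open Scope classical_set_scope.
Local Open Scope ring_scope.

(* These notions are stated for an arbitrary function [d], because [zeta]
   below is not a distance. *)
Section distance_notions.
Context {R : realType}.

Definition locally_finite (X : Type) (d : X -> X -> R) : Prop :=
  forall (x : X) (r : R), finite_set [set y | d x y < r].

Definition coarse_embedding (X Y : Type) (dX : X -> X -> R) (dY : Y -> Y -> R)
    (f : X -> Y) : Prop :=
  exists rho1 rho2 : R -> R,
    [/\ forall t, 0 <= t -> 0 <= rho1 t /\ 0 <= rho2 t,
        forall s t, 0 <= s -> s <= t -> rho1 s <= rho1 t /\ rho2 s <= rho2 t,
        forall x y, rho1 (dX x y) <= dY (f x) (f y) <= rho2 (dX x y) &
        rho1 t @[t --> +oo] --> +oo].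

End distance_notions.

Section generalized_roundness.
Context {R : realType} (X : metricType R).

(* At [p = 0] the value [0 `^ 0 = 1] is harmless: with either convention for
   0^0, the exponent 0 satisfies the inequality in every metric space. *)
Definition roundness_exponent (p : R) : Prop :=
  0 <= p /\
  forall (n : nat) (x y : 'I_n -> X), (2 <= n)%N ->
    \sum_(i < n) \sum_(j < n | (i < j)%N)
        (mdist (x i) (x j) `^ p + mdist (y i) (y j) `^ p)
    <= \sum_(i < n) \sum_(j < n) mdist (x i) (y j) `^ p.

Definition generalized_roundness : \bar R :=
  ereal_sup [set p%:E | p in roundness_exponent].

End generalized_roundness.

Section the_space.
Context (R : realType).

Definition L (n : nat) : set R :=
  [set x | exists k : int,
     [/\ 1 <= k, k <= n%:Z ^+ (2 * n) & x = k%:~R * n%:R ^- n]].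

Definition chi (n : nat) (x y : R) : R :=
  Num.min `|x - y| (n%:R ^+ n - `|x - y|).

Definition M (n : nat) : Type := {ffun 'I_(n ^ n) -> L n}.

(* The default value 0 does not affect the maximum: [n ^ n] is positive and
   [chi n] is nonnegative on [L n]. *)
Definition dinf (n : nat) (x y : M n) : R :=
  \big[Num.max/0]_(i < n ^ n) chi n (set_val (x i)) (set_val (y i)).

Definition pos_even : Type := {n : nat | (0 < n)%N && ~~ odd n}.

Definition Z : Type := {n : pos_even & M (val n)}.

(* [zeta] violates the triangle inequality: [M 8] has points at distance
   8 ^ 8 / 2 = 2 ^ 23, both at [zeta]-distance 4 ^ (8 + 2) = 2 ^ 20 from every
   point of [M 2].  Hence [Z] cannot be given a [metricType] structure with
   this distance. *)
Definition zeta (x y : Z) : R :=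
  if tag x == tag y then dinf (tagged x) (tagged_as x y)
  else 4 ^+ (val (tag x) + val (tag y)).

End the_space.

(* Main.v *)
Require Import Defs.
From mathcomp Require Import all_boot all_order all_algebra.
From mathcomp Require Import all_classical all_reals all_analysis.
From mathcomp Require Import ring lra zify.

(** For [f : M n -> B], regard [M n] as the group [(Z/Q)^N] with [Q = n^(2n)] and
    [N = n^n]; averaging [d (f z) (f (z + v)) ^ p] over [z] gives a function
    [phi v] of negative type.  Let [U e a] be the average of [phi] over
    all vectors with entries [+e] or [-e] on the coordinate set [a] and [0]
    elsewhere.  Split [a] into [a b] and [a ~b], and apply the roundness
    inequality to the points [x_s] (signs [s] times [e] on [a b]) and [y_s]
    (the same on [a ~b]): the differences [x_s - y_t] run over all sign vectors
    on [a], whereas [x_s - x_t] has entries [+-2e] on a random half of [a b].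
    Averaging over [b], the mean of [U (2e)] over random quarters of [a] is at
    most [U e a].  After [k] doublings the random active set is still nonempty
    with probability [1 - (1 - 4^-k)^N], which tends to 1 with [N].  So
    [rho1 (2^k) ^ p <= 2 rho2 1 ^ p] for all [k], contradicting
    [rho1 --> +oo]. *)

Set Implicit Arguments.
Unset Strict Implicit.
Unset Printing Implicit Defensive.

Import Order.TTheory GRing.Theory Num.Theory.

Local Open Scope classical_set_scope.
Local Open Scope ring_scope.

(** * Sign vectors on random coordinate sets and the doubling inequality *)

Section signed_vectors.
Variables (R : realFieldType) (I : finType) (A : finZmodType).

Local Notation V := {ffun I -> A}.
Local Notation B := {ffun I -> bool}.

Definition bor2 (f : bool -> bool -> bool) (a b : B) : B :=
  [ffun t => f (a t) (b t)].
Local Notation "a ⊓ b" := (bor2 andb a b) (at level 40, left associativity).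

Definition signed (e : A) (s a : B) : V :=
  [ffun t => if a t then if s t then e else - e else 0].

(** This is [x] to the size of [a], kept as a product so that sums over subsets factor
    coordinatewise. *)
Definition active_pow (x : R) (a : B) : R := \prod_t (if a t then x else 1).

Lemma sum_active_pow (x : R) (a : B) :
  \sum_(b : B) active_pow x (a ⊓ b) = #|{: B}|%:R * active_pow ((1 + x) / 2) a.
Proof.
rewrite card_ffun card_bool /active_pow.
have -> : \sum_(b : B) \prod_t (if (a ⊓ b) t then x else 1) =
  \sum_(b : B) \prod_t (if a t && b t then x else 1).
  by apply: eq_bigr => b _; apply: eq_bigr => t _; rewrite ffunE.
rewrite -(bigA_distr_bigA (fun t c => if a t && c then x else 1)) natrX.
rewrite -prodr_const -big_split /=; apply: eq_bigr => t _.
by rewrite big_bool; case: (a t) => /=; field.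
Qed.

Let sum_cst (c : R) : \sum_(b : B) c = #|{: B}|%:R * c.
Proof. by rewrite big_const iter_addr_0 mulr_natl. Qed.

Variable phi : V -> R.

(** The roundness inequality for the kernel [phi (v - u)]; each unordered pair is counted in both
    orders, whence the factor 2. *)
Definition neg_type := forall (S : finType) (X Y : S -> V),
  \sum_s \sum_t (phi (X t - X s) + phi (Y t - Y s)) <=
  2 * \sum_s \sum_t phi (Y t - X s).

Definition sign_sum (e : A) (a : B) : R := \sum_s phi (signed e s a).

Hypothesis phiN : neg_type.

(** Put [d = s xor t]: the difference vanishes where the signs agree and is [2e] with the sign of
    [t] where they differ. *)
Lemma sum_signed_sub (e : A) (a : B) :
  \sum_s \sum_t phi (signed e t a - signed e s a) =
  \sum_d sign_sum (e *+ 2) (a ⊓ d).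
Proof.
rewrite exchange_big /sign_sum [RHS]exchange_big /=; apply: eq_bigr => t _.
rewrite (reindex_inj (h := bor2 addb t)) /=; last first.
  move=> s s' /ffunP h; apply/ffunP => i.
  by have := h i; rewrite !ffunE => /addbI.
apply: eq_bigr => d _; congr phi; apply/ffunP => i; rewrite !ffunE.
case: (a i) (t i) (d i) => [] [] [] /=;
  by rewrite ?subr0 ?subrr ?opprK -?opprD -?mulr2n.
Qed.

Lemma sum_signed_split (e : A) (a b : B) :
  \sum_s \sum_t phi (signed e t (bor2 (fun u v => u && ~~ v) a b) -
    signed e s (a ⊓ b)) = #|{: B}|%:R * sign_sum e a.
Proof.
rewrite pair_bigA /=.
pose h (p : B * B) : B * B :=
  ([ffun i => if b i then ~~ p.1 i else p.2 i],
   [ffun i => if b i then p.2 i else p.1 i]).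
have h_inj : injective h.
  move=> [s t] [s' t'] [] /ffunP h1 /ffunP h2.
  congr pair; apply/ffunP => i; have := h1 i; have := h2 i; rewrite !ffunE /=;
    by case: (b i) => // _ /negb_inj.
pose G (p : B * B) := phi (signed e p.1 a).
rewrite (eq_bigr (fun p => G (h p))) => [|[s t] _]; last first.
  congr phi; apply/ffunP => i; rewrite !ffunE /=.
  by case: (a i) (b i) (s i) (t i) => [] [] [] [] /=;
    rewrite ?subr0 ?sub0r ?opprK.
rewrite -(reindex_inj h_inj (P := xpredT) (F := G)) /=.
rewrite -(pair_bigA _ (fun s t => G (s, t))) /= mulr_sumr.
by apply: eq_bigr => s _; rewrite /G /=; exact: sum_cst.
Qed.

Lemma sign_sum_double (e : A) (a : B) :
  \sum_b \sum_d sign_sum (e *+ 2) (a ⊓ b ⊓ d) <=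
  #|{: B}|%:R ^+ 2 * sign_sum e a.
Proof.
pose c b : B := bor2 (fun u v => u && ~~ v) a b.
have le_b b : \sum_d sign_sum (e *+ 2) (a ⊓ b ⊓ d) +
    \sum_d sign_sum (e *+ 2) (c b ⊓ d) <= 2 * (#|{: B}|%:R * sign_sum e a).
  rewrite -!sum_signed_sub -(sum_signed_split e a b) -big_split /=.
  under eq_bigr => s _ do rewrite -big_split /=.
  exact: phiN.
have := ler_sum (index_enum B) (P := xpredT) (fun b _ => le_b b).
(* Complementing [b] exchanges [a ⊓ b] and [c b], so both double sums are equal. *)
rewrite big_split /= sum_cst -[X in _ + X](_ : \sum_b \sum_d
  sign_sum (e *+ 2) (a ⊓ b ⊓ d) = _); last first.
  have neg_inj : injective (fun b : B => [ffun i => ~~ b i] : B).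
    move=> s s' /ffunP h; apply/ffunP => i.
    by have := h i; rewrite !ffunE => /negb_inj.
  rewrite (reindex_inj neg_inj) /=; apply: eq_bigr => b _.
  apply: eq_bigr => d _; congr sign_sum; apply/ffunP => i.
  by rewrite !ffunE.
set T := \sum_b _; set m := (#|_|%:R); set u := sign_sum _ _.
by move=> hT; lra.
Qed.

Hypothesis phi_ge0 : forall v, 0 <= phi v.

(** Each doubling keeps an active coordinate with probability 1/4, so [active_pow (1 - 4 ^- k) a] is
    the probability that none survives [k] doublings; in that event only [phi >= 0] is available. *)
Lemma sign_sum_ge (r : R) (k : nat) (e : A) (a : B) :
  (forall (s c : B) i, c i -> r <= phi (signed (e *+ 2 ^ k) s c)) ->
  #|{: B}|%:R * r * (1 - active_pow (1 - 4 ^- k) a) <= sign_sum e a.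
Proof.
elim: k e a => [|k IHk] e a.
  rewrite expn0 mulr1n expr0 invr1 subrr => hr.
  case: (pickP a) => [i ai|a0].
    rewrite /active_pow (bigD1 i) //= ai mul0r subr0 mulr1.
    rewrite -sum_cst; apply: ler_sum => s _; exact: hr ai.
  rewrite /active_pow big1 => [|i _]; last by rewrite a0.
  by rewrite subrr mulr0 sumr_ge0.
move=> hr.
have {}IHk c : #|{: B}|%:R * r * (1 - active_pow (1 - 4 ^- k) c) <=
    sign_sum (e *+ 2) c.
  by apply: IHk => s c' i ci; rewrite -mulrnA -expnS; exact: hr ci.
have := sign_sum_double e a.
have hs := ler_sum (index_enum B) (P := xpredT) (fun b _ =>
  ler_sum (index_enum B) (P := xpredT) (fun d _ => IHk (a ⊓ b ⊓ d))).
move=> /(le_trans hs) {hs}.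
set m : R := #|{: B}|%:R.
have m_gt0 : 0 < m by rewrite ltr0n; apply/card_gt0P; exists [ffun=> true].
under eq_bigr => b _ do rewrite -mulr_sumr sumrB sum_cst sum_active_pow.
rewrite -mulr_sumr sumrB sum_cst -mulr_sumr sum_active_pow -/m.
(* The averages over [d] and [b] each halve the survival probability. *)
have -> : (1 + (1 + (1 - 4 ^- k)) / 2) / 2 = 1 - 4 ^- k.+1 :> R.
  by rewrite exprS invfM; field; rewrite expf_neq0 // pnatr_eq0.
set th := active_pow _ _; set u := sign_sum _ _.
have -> : m * r * (m * (m * 1) - m * (m * th)) =
    m ^+ 2 * (m * r * (1 - th)).
  by ring.
by rewrite ler_pM2l // exprn_gt0.
Qed.

End signed_vectors.

(** * From generalized roundness to functions of negative type *)

Lemma neg_type_translates (R : realFieldType) (I : finType) (A : finZmodType)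
    (F : {ffun I -> A} -> {ffun I -> A} -> R) :
  (forall (S : finType) (X Y : S -> {ffun I -> A}),
    \sum_s \sum_t (F (X s) (X t) + F (Y s) (Y t)) <=
    2 * \sum_s \sum_t F (X s) (Y t)) ->
  neg_type (fun v => \sum_z F z (z + v)).
Proof.
move=> hF S X Y.
(* Summing over all translates [z] makes the kernel depend on [v - u] only; the hypothesis is then
   applied to the families [z + X s] and [z + Y s]. *)
have shift (u v : {ffun I -> A}) :
    \sum_(z : {ffun I -> A}) F z (z + (v - u)) = \sum_(z : {ffun I -> A}) F (z + u) (z + v).
  rewrite (reindex (fun z : {ffun I -> A} => z + u)) /=; last first.
    by exists (fun z : {ffun I -> A} => z - u) => z _; rewrite ?addrK ?subrK.
  apply: eq_bigr => z _.
  by rewrite -addrA subrKC.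
under eq_bigr => s _.
  under eq_bigr => t _ do rewrite !shift -big_split.
  rewrite exchange_big; over.
rewrite exchange_big /=.
under [X in _ <= _ * X]eq_bigr => s _.
  under eq_bigr => t _ do rewrite shift.
  rewrite exchange_big; over.
rewrite [X in _ <= _ * X]exchange_big /= mulr_sumr.
by apply: ler_sum => z _; exact: (hF S (fun s => z + X s) (fun s => z + Y s)).
Qed.

Lemma sum_sym_lt (R : realFieldType) (n : nat) (g : 'I_n -> 'I_n -> R) :
  (forall i j, g i j = g j i) -> (forall i, g i i = 0) ->
  \sum_i \sum_j g i j = 2 * \sum_(i < n) \sum_(j < n | (i < j)%N) g i j.
Proof.
move=> gC g0; rewrite mulr_natl mulr2n.
rewrite [X in _ = _ + X](_ : _ = \sum_(i < n) \sum_(j < n | (j < i)%N) g i j).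
  rewrite -big_split /=; apply: eq_bigr => i _.
  rewrite [X in _ = X + _]big_mkcond [X in _ = _ + X]big_mkcond -big_split /=.
  apply: eq_bigr => j _; case: ltngtP => [||/val_inj ->];
  by rewrite ?addr0 ?add0r ?g0.
rewrite [RHS](exchange_big_dep xpredT) //=.
by apply: eq_bigr => i _; apply: eq_bigr => j _.
Qed.

Lemma roundness_neg_type (R : realType) (B : metricType R) (p : R) :
  0 < p -> roundness_exponent B p -> forall (S : finType) (X Y : S -> B),
  \sum_s \sum_t (mdist (X s) (X t) `^ p + mdist (Y s) (Y t) `^ p) <=
  2 * \sum_s \sum_t mdist (X s) (Y t) `^ p.
Proof.
move=> p0 [_ hp] S X Y.
have dxx (b : B) : mdist b b `^ p = 0 by rewrite mdistxx powR0 // gt_eqF.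
(* [roundness_exponent] speaks of at least two points; with fewer, the left side is 0. *)
have [S1|S2] := leqP #|S| 1.
  rewrite big1 => [|s _].
    apply: mulr_ge0 => //; apply: sumr_ge0 => s _; apply: sumr_ge0 => t _.
    exact: powR_ge0.
  rewrite big1 // => t _.
  by rewrite (fintype_le1P S1 s t) !dxx addr0.
have enumE (h : S -> S -> R) : \sum_s \sum_t h s t =
    \sum_(i < #|S|) \sum_(j < #|S|) h (enum_val i) (enum_val j).
  rewrite (reindex (@enum_val _ S)) /=; last exact/onW_bij/enum_val_bij.
  apply: eq_bigr => i _.
  by rewrite (reindex (@enum_val _ S)) //=; exact/onW_bij/enum_val_bij.
rewrite !enumE sum_sym_lt.
- by rewrite ler_pM2l //; exact: hp.
- by move=> i j; rewrite ![mdist _ (_ (enum_val i))]metric_sym.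
- by move=> i; rewrite !dxx addr0.
Qed.

(** * The cyclic metric on [L n] as a metric on Z/Q *)

Section lattice.
Variables (R : realType) (n : nat).
Hypothesis n_gt0 : (0 < n)%N.

Let Q := (n ^ (2 * n))%N.
Local Notation A := 'I_Q.-1.+1.

Let Q_gt0 : (0 < Q)%N. Proof. by rewrite expn_gt0 n_gt0. Qed.

Let A_lt (r : A) : (r < Q)%N. Proof. by rewrite -[ltnRHS]prednK. Qed.

(** Residue [r] stands for [k = r + 1], since [k] starts at 1 in [L n]. *)
Lemma L_residue (r : A) : @L R n (r.+1%:R * n%:R ^- n).
Proof.
exists r.+1%:Z; split => //.
have := A_lt r; rewrite -lez_nat /Q -!natz natrX => /le_trans; apply.
by rewrite lexx.
Qed.

Definition residue (r : A) : @L R n := SigSub (mem_set (L_residue r)).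

Lemma residue_surj (x : @L R n) : exists r : A, x = residue r.
Proof.
have [k [k1 kn xE]] := set_mem (valP x).
case: k k1 kn xE => // -[//|k] _ kn xE.
have kQ : (k < Q.-1.+1)%N.
  by rewrite prednK //; move: kn; rewrite -!natz -natrX !natz lez_nat.
by exists (Ordinal kQ); apply: val_inj.
Qed.

Lemma chi_residue (z c : A) :
  chi n (set_val (residue z)) (set_val (residue (z + c))) =
  (minn c (Q - c))%:R * n%:R ^- n.
Proof.
rewrite /chi /=; set d : R := n%:R ^- n.
have d_gt0 : 0 < d by rewrite invr_gt0 exprn_gt0 // ltr0n.
have -> : n%:R ^+ n = Q%:R * d.
  rewrite natrX mulnC exprM expr2 mulfK //.
  by rewrite expf_neq0 // pnatr_eq0 -lt0n.
rewrite -mulrBl normrM (gtr0_norm d_gt0) -mulrBl.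
have zQ := A_lt z; have cQ := A_lt c.
have minE (a b : nat) : Num.min (a%:R * d) (b%:R * d) = (minn a b)%:R * d.
  by rewrite minEle ler_pM2r // ler_nat /minn; case: ltngtP => // ->.
have -> : val (z + c) = ((z + c) %% Q)%N by rewrite /=; congr modn; rewrite prednK.
rewrite -[in RHS]minE.
(* Without wrap-around the absolute difference is [c] steps, otherwise [Q - c]; the minimum is the
   same. *)
have [zc|Qzc] := ltnP (z + c) Q.
  rewrite modn_small // natrB 1?ltnW // -addSn natrD opprD addrA subrr add0r.
  by rewrite normrN normr_nat.
rewrite -[X in (X %% Q)%N](subnK Qzc) modnDr modn_small; last by lia.
have -> : z.+1%:R - (z + c - Q).+1%:R = (Q - c)%:R :> R.
  by rewrite -natrB; [congr (_%:R)|]; lia.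
rewrite normr_nat -natrB; last by lia.
by rewrite !minE; congr ((_ %:R) * _); lia.
Qed.

End lattice.

(** * The group structure on [M n] and the resulting bound for maps on it *)

Section residue_vectors.
Variables (R : realType) (n : nat).
Hypothesis n_gt0 : (0 < n)%N.

Local Notation A := 'I_(n ^ (2 * n)).-1.+1.
Local Notation V := {ffun 'I_(n ^ n) -> A}.

Definition residue_vector (v : V) : M R n := [ffun i => residue R n_gt0 (v i)].

Lemma dinf_ge0 (x y : M R n) : 0 <= dinf x y.
Proof. exact: bigmax_ge_id. Qed.

(** Neighbouring residues are [n ^- n] apart, so [n ^ n] of them make length 1. *)
Definition unit_step : A := inZp (n ^ n).

Lemma chi_unit_step (z : A) (k : nat) (s : bool) : (2 ^ k.+1 <= n)%N ->
  let c := unit_step *+ 2 ^ k in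
  chi n (set_val (residue R n_gt0 z))
    (set_val (residue R n_gt0 (z + (if s then c else - c)))) = 2 ^+ k.
Proof.
move=> kn c; rewrite chi_residue.
have nn_gt0 : (0 < n ^ n)%N by rewrite expn_gt0 n_gt0.
have QE : (n ^ (2 * n) = n ^ n * n ^ n)%N by rewrite mulnC expnM.
(* The step is at most half the circle, so in either direction its length is its distance. *)
have kQ : (2 * (n ^ n * 2 ^ k) <= n ^ (2 * n))%N.
  rewrite QE mulnCA leq_mul2l; apply/orP; right.
  rewrite -expnS (leq_trans kn) // -[leqLHS]expn1 leq_pexp2l //; lia.
have k_gt0 : (0 < n ^ n * 2 ^ k)%N by rewrite muln_gt0 nn_gt0 expn_gt0.
have cE : val c = (n ^ n * 2 ^ k)%N.
  rewrite /c Zp_mulrn /= modnMml modn_small // prednK; last by lia.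
  by lia.
have -> : minn (if s then c else - c) (n ^ (2 * n) - (if s then c else - c)%R)
    = (n ^ n * 2 ^ k)%N.
  case: s; first by rewrite cE; lia.
  have -> : val (- c) = (n ^ (2 * n) - n ^ n * 2 ^ k)%N.
    rewrite /= -/(val c) cE prednK; last by lia.
    by rewrite modn_small //; lia.
  lia.
rewrite natrM !natrX mulrAC mulfV ?mul1r //.
by rewrite expf_neq0 // pnatr_eq0 -lt0n.
Qed.

Lemma dinf_signed_ge (z : V) (k : nat) (s c : {ffun 'I_(n ^ n) -> bool})
    (i : 'I_(n ^ n)) : (2 ^ k.+1 <= n)%N -> c i ->
  2 ^+ k <= dinf (residue_vector z)
    (residue_vector (z + signed (unit_step *+ 2 ^ k) s c)).
Proof.
move=> kn ci; rewrite -(chi_unit_step (z i) (s i) kn) /dinf.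
by apply: (bigmax_sup i) => //; rewrite !ffunE ci.
Qed.

Lemma dinf_signed_le (z : V) (s c : {ffun 'I_(n ^ n) -> bool}) :
  (1 < n)%N -> (forall i, c i) ->
  dinf (residue_vector z) (residue_vector (z + signed unit_step s c)) <= 1.
Proof.
move=> n1 cT; rewrite /dinf; apply: bigmax_le => // i _; rewrite !ffunE cT.
by rewrite (@chi_unit_step (z i) 0 (s i)).
Qed.

Lemma roundness_dinf (B : metricType R) (p r0 r : R) (k : nat) (f : M R n -> B) :
  0 < p -> roundness_exponent B p -> (2 ^ k.+1 <= n)%N ->
  (forall x y, dinf x y <= 1 -> mdist (f x) (f y) `^ p <= r0) ->
  (forall x y, 2 ^+ k <= dinf x y -> r <= mdist (f x) (f y) `^ p) ->
  r * (1 - (1 - 4 ^- k) ^+ (n ^ n)) <= r0.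
Proof.
move=> p_gt0 hp kn f_le f_ge.
pose F (u v : V) := mdist (f (residue_vector u)) (f (residue_vector v)) `^ p.
pose phi v := \sum_(z : V) F z (z + v).
have phiN : neg_type phi.
  apply: neg_type_translates => S X Y.
  exact: (roundness_neg_type p_gt0 hp (fun s => f (residue_vector (X s)))).
have phi_ge0 v : 0 <= phi v by apply: sumr_ge0 => z _; exact: powR_ge0.
have sum_cst (T : finType) (c : R) : \sum_(b : T) c = #|{: T}|%:R * c.
  by rewrite big_const iter_addr_0 mulr_natl.
pose one : {ffun 'I_(n ^ n) -> bool} := [ffun=> true].
(* [phi] is a sum over [z], not an average, so bounds on it carry the factor [#|V|]. *)
have lower := @sign_sum_ge _ _ _ _ phiN phi_ge0 (#|{: V}|%:R * r) k unit_step one.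
have {lower} := lower _.
have -> : active_pow (1 - 4 ^- k) one = (1 - 4 ^- k) ^+ (n ^ n) :> R.
  rewrite /active_pow -[RHS](_ : \prod_(i < n ^ n) (1 - 4 ^- k) = _); last first.
    by rewrite prodr_const card_ord.
  by apply: eq_bigr => i _; rewrite ffunE.
move=> lower.
have upper : sign_sum phi unit_step one <=
    #|{: {ffun 'I_(n ^ n) -> bool}}|%:R * (#|{: V}|%:R * r0).
  rewrite -sum_cst; apply: ler_sum => s _; rewrite -sum_cst.
  apply: ler_sum => z _; apply/f_le/dinf_signed_le => [|i]; last by rewrite ffunE.
  by apply: leq_trans kn; rewrite expnS; have := expn_gt0 2 k; lia.
have cB : 0 < #|{: {ffun 'I_(n ^ n) -> bool}}|%:R :> R.
  by rewrite ltr0n; apply/card_gt0P; exists one.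
have cV : 0 < #|{: V}|%:R :> R.
  by rewrite ltr0n; apply/card_gt0P; exists [ffun=> 0].
rewrite -(ler_pM2l cV) -(ler_pM2l cB) [X in _ * X]mulrA [leLHS]mulrA.
apply: le_trans upper; apply: lower => s c i ci.
rewrite -sum_cst; apply: ler_sum => z _; apply: f_ge; exact: dinf_signed_ge ci.
Qed.

End residue_vectors.

(** * Local finiteness *)

Lemma finite_M (R : realType) (n : nat) : (0 < n)%N -> finite_set [set: M R n].
Proof.
move=> n_gt0; apply: (@sub_finite_set _ _ (range (@residue_vector R n n_gt0))).
  move=> x _; have [g gE] := choice (fun i => residue_surj n_gt0 (x i)).
  by exists [ffun i => g i] => //; apply/ffunP => i; rewrite !ffunE gE.
exact/finite_image/finite_finset.
Qed.

Lemma finite_Z_tag (R : realType) (n : nat) :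
  finite_set [set y : Z R | val (tag y) = n].
Proof.
have [[m mn]|noM] := pselect (exists m : pos_even, val m = n); last first.
  by apply: (@sub_finite_set _ _ set0) => // y yn; apply: noM; exists (tag y).
have m_gt0 : (0 < val m)%N by have /andP[] := valP m.
apply: sub_finite_set (finite_image (existT (fun k => M R (val k)) m)
  (finite_M R m_gt0)).
move=> [k y] /= kn; have km : k = m by apply: val_inj; rewrite mn.
by move: y; rewrite km => y; exists y.
Qed.

Lemma locally_finite_zeta (R : realType) : locally_finite (@zeta R).
Proof.
(* Outside the component of [x], a point of [M n] in the ball satisfies [n <= 4 ^ (m + n) < r],
   where [m] is the index of [x]. *)
move=> x r; pose N := maxn (Num.truncn r) (val (tag x)).
apply: (@sub_finite_set _ _
  (\bigcup_(n in `I_N.+1) [set y : Z R | val (tag y) = n])); last first.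
  by apply: bigcup_finite => [|n _]; [exact: finite_II | exact: finite_Z_tag].
move=> y /= xy; exists (val (tag y)) => //=; rewrite ltnS leq_max; move: xy.
rewrite /zeta; case: eqVneq => [E _|_ xy]; first by rewrite E leqnn orbT.
have r0 : 0 <= r by rewrite (le_trans _ (ltW xy)) ?exprn_ge0.
rewrite truncn_ge_nat // (le_trans _ (ltW xy)) // -natrX ler_nat.
by rewrite (leq_trans (leq_addl (val (tag x)) _)) // ltnW // ltn_expl.
Qed.

(** * The contradiction from a coarse embedding *)

Lemma bernoulli_inv (R : realFieldType) (q : R) (n : nat) : 0 <= q <= 1 ->
  (1 - q) ^+ n * (1 + n%:R * q) <= 1.
Proof.
move=> /andP[q0 q1]; elim: n => [|n IH]; first by rewrite mul0r addr0 mulr1.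
apply: le_trans IH; rewrite exprSr -mulrA ler_wpM2l ?exprn_ge0 ?subr_ge0 //.
(* What remains is [(1 - q) * (1 + (n + 1) * q) <= 1 + n * q]. *)
by rewrite -natr1; have := ler0n R n; nra.
Qed.

Lemma no_coarse_embedding (R : realType) (B : metricType R) :
  (0 < generalized_roundness B)%E ->
  ~ exists f : Z R -> B, coarse_embedding (@zeta R) (@mdist R B) f.
Proof.
move=> /ereal_sup_gt[_ [p hp <-]]; rewrite lte_fin => p_gt0.
move=> [f [rho1 [rho2 [rho_ge0 rho_mono f_rho rho1_oo]]]].
(* The summand 1 makes [c / 2 <= rho2 1 ^ p] impossible. *)
pose c := 2 * rho2 1 `^ p + 1.
have c_ge0 : 0 <= c by rewrite addr_ge0 // mulr_ge0 // powR_ge0.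
have [T [_ rho1_T]] := (cvgryPge rho1).1 rho1_oo (c `^ p^-1).
pose k := (Num.truncn T).+1.
have T_k : T < 2 ^+ k.
  apply: lt_le_trans (truncnS_gt T) _.
  by rewrite -natrX ler_nat ltnW // ltn_expl.
have k_ge0 : 0 <= 2 ^+ k :> R by rewrite exprn_ge0.
have rho1_k : c <= rho1 (2 ^+ k) `^ p.
  have -> : c = (c `^ p^-1) `^ p.
    by rewrite -powRrM mulVf ?powRr1 // gt_eqF.
  apply: ge0_ler_powR; rewrite ?nnegrE ?powR_ge0 ?(ltW p_gt0) ?rho1_T //.
  by have [] := rho_ge0 _ k_ge0.
(* This [n] is even, leaves room for [k] doublings, and gives [n ^ n >= 4 ^ k]. *)
pose n := (4 ^ k.+1)%N.
have n_gt0 : (0 < n)%N by rewrite expn_gt0.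
have n_even : (0 < n)%N && ~~ odd n by rewrite n_gt0 oddX.
have kn : (2 ^ k.+1 <= n)%N by rewrite leq_exp2r.
pose m : pos_even := exist _ n n_even.
pose g (x : M R n) : B := f (existT (fun k => M R (val k)) m x).
have zetaE (x y : M R n) : zeta (existT (fun k => M R (val k)) m x)
    (existT (fun k => M R (val k)) m y) = dinf x y.
  by rewrite /zeta /= eqxx tagged_asE.
have g_le x y : dinf x y <= 1 -> mdist (g x) (g y) `^ p <= rho2 1 `^ p.
  move=> xy; have /andP[_ d_le] := f_rho (existT _ m x) (existT _ m y).
  apply: ge0_ler_powR; rewrite ?nnegrE ?mdist_ge0 ?(ltW p_gt0) //.
    by have [] := rho_ge0 1.
  apply: le_trans d_le _; rewrite zetaE.
  by have [] := rho_mono _ _ (dinf_ge0 x y) xy.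
have g_ge x y : 2 ^+ k <= dinf x y -> c <= mdist (g x) (g y) `^ p.
  move=> xy; have /andP[d_ge _] := f_rho (existT _ m x) (existT _ m y).
  apply: le_trans rho1_k _.
  apply: ge0_ler_powR; rewrite ?nnegrE ?mdist_ge0 ?(ltW p_gt0) //.
    by have [] := rho_ge0 _ k_ge0.
  apply: le_trans d_ge; rewrite zetaE.
  by have [] := rho_mono _ _ k_ge0 xy.
have := roundness_dinf n_gt0 p_gt0 hp kn g_le g_ge.
set q := 4 ^- k; have q_gt0 : 0 < q :> R by rewrite invr_gt0 exprn_gt0.
have q01 : 0 <= q <= 1.
  by rewrite ltW //= /q invf_le1 ?exprn_gt0 // exprn_ege1 // ler1n.
have := bernoulli_inv (n ^ n) q01.
have Nq : 1 <= (n ^ n)%:R * q :> R.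
  rewrite ler_pdivlMr ?exprn_gt0 // mul1r -natrX ler_nat.
  rewrite (@leq_trans n) ?leq_pexp2l // -[leqLHS]expn1 leq_pexp2l //.
have : 0 <= (1 - q) ^+ (n ^ n) by rewrite exprn_ge0 // subr_ge0; case/andP: q01.
(* As [n ^ n * q >= 1], the Bernoulli bound gives [(1 - q) ^ (n ^ n) <= 1/2], whence
   [c / 2 <= rho2 1 ^ p]. *)
have := powR_ge0 (rho2 1) p; rewrite /c.
by set x : R := (n ^ n)%:R * q in Nq *; nra.
Qed.

Local Open Scope ereal_scope.

Theorem theorem3p1 (R : realType) :
  locally_finite (@zeta R) /\
  forall B : metricType R, 0 < generalized_roundness B ->
    ~ exists f : Z R -> B, coarse_embedding (@zeta R) (@mdist R B) f.
Proof.
split; [exact: locally_finite_zeta | exact: no_coarse_embedding].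
Qed.
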